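(* Let $n>2$ and $t>2$ be two positive integers. Then \[\varphi(P_n \boxdot S_t) = \begin{cases} 2n-1, & \text{if } n\leq \frac {t+3}2,\\ t+2, & \text{if }n=\left\lceil\frac {t+4}2\right\rceil,\\ t+3, & \text{if } \left\lceil\frac {t+4}2\right\rceil < n \leq t+4,\\ n-1, & \text{if } t+4<n\leq 2t+5,\\ 2t+5, & \text{otherwise}. \end{cases}\]
   Context: All graphs are finite and simple. $P_n$ denotes the path with $n$ vertices and $S_t$ denotes the star with $t$ leaves (so it has $t+1$ vertices). The subdivision graph $S(G)$ of a graph $G$ is obtained by inserting one new vertex into every edge of $G$. For graphs $G$ and $H$, with $V(G)=\{u_0,\ldots,u_{m-1}\}$, the subdivision-vertex neighbourhood corona (SVN corona) $G\boxdot H$ is the graph obtained from $S(G)$ by adding $m$ vertex-disjoint copies of $H$ (one for each $u_i$) and joining, for each $i$, every vertex of $N_{S(G)}(u_i)$ (the neighbourhood of $u_i$ in $S(G)$) to every vertex of the copy of $H$ associated with $u_i$. A $b$-chromatic coloring of a graph with $k$ colors is a proper coloring with colors $0,\ldots,k-1$ such that, for each color $i$, there is a vertex (a $b$-vertex) of color $i$ having, for each color $j\neq i$, a neighbour of color $j$. The $b$-chromatic number $\varphi(G)$ is the maximum $k$ for which $G$ has a $b$-chromatic coloring with $k$ colors. *)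

(* Defs.v *)
From mathcomp Require Import all_boot.

Set Implicit Arguments.
Unset Strict Implicit.
Unset Printing Implicit Defensive.

Record sgraph := SGraph {
  svertex :> finType;
  sedge : rel svertex;
  sedge_sym : symmetric sedge;
  sedge_irr : irreflexive sedge
}.

Definition path_rel (n : nat) : rel 'I_n :=
  fun i j => (i.+1 == j :> nat) || (j.+1 == i :> nat).

Lemma path_rel_sym n : symmetric (@path_rel n).
Proof. by move=> i j; rewrite /path_rel orbC. Qed.

Lemma path_rel_irr n : irreflexive (@path_rel n).
Proof. by move=> i; rewrite /path_rel orbb eqn_leq ltnn. Qed.

Definition path_graph (n : nat) : sgraph :=
  SGraph (@path_rel_sym n) (@path_rel_irr n).

(* [None] is the centre, [Some i] are the leaves. *)
Definition star_rel (t : nat) : rel (option 'I_t) :=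
  fun x y => (x == None) != (y == None).

Lemma star_rel_sym t : symmetric (@star_rel t).
Proof. by move=> x y; rewrite /star_rel eq_sym. Qed.

Lemma star_rel_irr t : irreflexive (@star_rel t).
Proof. by move=> x; rewrite /star_rel eqxx. Qed.

Definition star_graph (t : nat) : sgraph :=
  SGraph (@star_rel_sym t) (@star_rel_irr t).

Definition edge_set (G : sgraph) : {set {set G}} :=
  [set [set p.1; p.2] | p : G * G & sedge p.1 p.2].

Definition edge_of (G : sgraph) : finType := {e : {set G} | e \in edge_set G}.

(* An edge [e] of [G] stands for the new vertex inserted into it. *)
Definition subdivision_rel (G : sgraph) : rel (G + edge_of G)%type :=
  fun a b =>
    match a, b with
    | inl u, inr e | inr e, inl u => u \in val e
    | _, _ => false
    end.

Lemma subdivision_rel_sym G : symmetric (@subdivision_rel G).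
Proof. by case=> [u|e] []. Qed.

Lemma subdivision_rel_irr G : irreflexive (@subdivision_rel G).
Proof. by case. Qed.

Definition subdivision (G : sgraph) : sgraph :=
  SGraph (@subdivision_rel_sym G) (@subdivision_rel_irr G).

(* [inr (u, h)] is the vertex [h] in the copy of [H] associated with [u]. *)
Definition svn_corona_rel (G H : sgraph) : rel (subdivision G + G * H)%type :=
  fun a b =>
    match a, b with
    | inl x, inl y => sedge x y
    | inl x, inr (u, _) | inr (u, _), inl x => sedge (inl u : subdivision G) x
    | inr (u, h), inr (v, k) => (u == v) && sedge h k
    end.

Lemma svn_corona_rel_sym G H : symmetric (@svn_corona_rel G H).
Proof.
case=> [x|[u h]] [y|[v k]] //; first exact: sedge_sym.
by rewrite /svn_corona_rel eq_sym (@sedge_sym H).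
Qed.

Lemma svn_corona_rel_irr G H : irreflexive (@svn_corona_rel G H).
Proof.
case=> [x|[u h]]; first exact: sedge_irr.
by rewrite /svn_corona_rel sedge_irr andbF.
Qed.

Definition svn_corona (G H : sgraph) : sgraph :=
  SGraph (@svn_corona_rel_sym G H) (@svn_corona_rel_irr G H).

Section BChromatic.
Variable G : sgraph.

Definition proper_coloring (k : nat) (c : {ffun G -> 'I_k}) : bool :=
  [forall x : G, forall y : G, sedge x y ==> (c x != c y)].

Definition b_vertex (k : nat) (c : {ffun G -> 'I_k}) (x : G) : bool :=
  [forall j : 'I_k, (j != c x) ==> [exists y : G, sedge x y && (c y == j)]].

Definition b_coloring (k : nat) (c : {ffun G -> 'I_k}) : bool :=
  proper_coloring c &&
  [forall i : 'I_k, exists x : G, (c x == i) && b_vertex c x].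

Definition b_colorable (k : nat) : bool :=
  [exists c : {ffun G -> 'I_k}, b_coloring c].

(* A b-coloring uses all its colors, so no [k > #|G|] is missed; that the      *)
(* maximum is attained is [b_chromatic_number_attained] below.                *)
Definition b_chromatic_number : nat :=
  \max_(k < #|G|.+1 | b_colorable k) k.

Lemma b_colorable_le_card k : b_colorable k -> k <= #|G|.
Proof.
case/existsP=> c /andP[_ /forallP cb].
have cP (i : 'I_k) : exists x, c x == i.
  by have /existsP[x /andP[cx _]] := cb i; exists x.
have fK : cancel (fun i => xchoose (cP i)) c.
  by move=> i; apply/eqP; exact: (xchooseP (cP i)).
by rewrite -[k]card_ord; exact: leq_card (can_inj fK).
Qed.

Lemma b_chromatic_number_max k : b_colorable k -> k <= b_chromatic_number.
Proof.
move=> kb; have kG : k < #|G|.+1 by rewrite ltnS b_colorable_le_card.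
exact: (leq_bigmax_cond (Ordinal kG)).
Qed.

(* A proper coloring with the fewest colors is a b-coloring. *)
Lemma ex_b_colorable : exists k, b_colorable k.
Proof.
pose P k := [exists c : {ffun G -> 'I_k}, proper_coloring c].
have exP : exists k, P k.
  exists #|G|; apply/existsP; exists [ffun x => enum_rank x].
  apply/forallP=> x; apply/forallP=> y; apply/implyP=> xy.
  rewrite !ffunE; apply/eqP=> /enum_rank_inj xE.
  by rewrite xE sedge_irr in xy.
case: (ex_minnP exP) => k /existsP[c cP] kmin.
exists k; apply/existsP; exists c; rewrite /b_coloring cP /=.
apply/negPn/negP; rewrite negb_forall => /existsP[i].
rewrite negb_exists => /forallP iN.
case: k i c cP kmin iN => [[]//|k] i c cP kmin iN.
suff /kmin : P k by rewrite ltnn.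
have free x : exists j : 'I_k,
    if c x == i then [forall y, sedge x y ==> (c y != lift i j)]
    else c x == lift i j.
  have := iN x; case: eqP => [cx /= | /eqP cx _].
    rewrite negb_forall => /existsP[j].
    rewrite negb_imply cx eq_sym => /andP[/unlift_some[j' -> _]].
    rewrite negb_exists => /forallP jN; exists j'.
    by apply/forallP=> y; rewrite implybE -negb_and.
  by move: cx; rewrite eq_sym => /unlift_some[j -> _]; exists j.
pose d := [ffun x => xchoose (free x)].
have dP x : if c x == i then [forall y, sedge x y ==> (c y != lift i (d x))]
            else c x == lift i (d x) by rewrite /d ffunE; exact: (xchooseP (free x)).
apply/existsP; exists d; apply/forallP=> x; apply/forallP=> y.
apply/implyP=> xy; apply/eqP=> dxy.
have /forallP/(_ x)/forallP/(_ y) := cP; rewrite xy /= => /negP; apply.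
have := dP x; have := dP y; rewrite dxy.
case: (c y =P i) => [cy|_].
  case: (c x =P i) => [cx|_]; first by rewrite cx cy.
  move=> /forallP/(_ x); rewrite sedge_sym xy /= => /negP cN cx.
  by case: cN.
move=> /eqP cy; case: (c x =P i) => [_|_ /eqP->]; last by rewrite cy.
by move=> /forallP/(_ y); rewrite xy cy eqxx.
Qed.

Lemma b_chromatic_number_attained : b_colorable b_chromatic_number.
Proof.
have [k kb] := ex_b_colorable.
have kG : k < #|G|.+1 by rewrite ltnS b_colorable_le_card.
have : 0 < #|[pred k : 'I_#|G|.+1 | b_colorable k]|.
  by apply/card_gt0P; exists (Ordinal kG).
by case/(eq_bigmax_cond (@nat_of_ord _)) => m mb; rewrite /b_chromatic_number => ->.
Qed.

End BChromatic.

(* Main.v *)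
(** A b-coloring with [k] colors needs [k] vertices of degree at least [k - 1];
    since only edge vertices and star centres have large degree, this bounds
    [k] from above.  The bound is attained: for [k >= t + 4] the edge vertices
    alone serve as b-vertices of a coloring that is periodic modulo [k], and
    for [k <= t + 3] the edge vertices get distinct colors, the missing colors
    are put on centres, and each leaf sees so few vertices that the leaves of a
    copy can carry every color absent from its centre's neighbourhood. *)

Require Import Defs.
From mathcomp Require Import all_boot zify.

Set Implicit Arguments.
Unset Strict Implicit.
Unset Printing Implicit Defensive.

(** * Colorings by natural numbers and counting bounds in any graph *)

Lemma b_colorable_of_nat (G : sgraph) (k : nat) (f : G -> nat) :
  (forall x, f x < k) ->
  (forall x y, sedge x y -> f x <> f y) ->
  (forall a, a < k -> exists2 x, f x = a &
     forall b, b < k -> b <> a -> exists2 y, sedge x y & f y = b) ->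
  b_colorable G k.
Proof.
move=> fk fP fb; apply/existsP; exists [ffun x => Ordinal (fk x)].
apply/andP; split.
  apply/forallP=> x; apply/forallP=> y; apply/implyP=> xy.
  by rewrite !ffunE -val_eqE /=; apply/eqP; exact: fP.
apply/forallP=> a; have [x fx xb] := fb a (ltn_ord a).
apply/existsP; exists x; rewrite ffunE -val_eqE /= fx eqxx /=.
apply/forallP=> b; apply/implyP; rewrite ffunE -val_eqE /= fx => /eqP ba.
have [y xy fy] := xb b (ltn_ord b) ba.
by apply/existsP; exists y; rewrite xy ffunE -val_eqE /= fy eqxx.
Qed.

(** The colors of [x] and of [s] exhaust all [k] colors. A covering list replaces the degree, so
    repetitions and non-neighbours in [s] do no harm. *)
Lemma b_vertex_degree (G : sgraph) (k : nat) (c : {ffun G -> 'I_k}) (x : G)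
    (s : seq G) :
  b_vertex c x -> (forall y, sedge x y -> y \in s) -> k <= (size s).+1.
Proof.
move=> /forallP xb sP; rewrite -(size_map c) -[leqRHS]/(size (c x :: map c s)).
rewrite -[k in k <= _]size_enum_ord; apply: uniq_leq_size (enum_uniq _) _ => j _.
rewrite inE; have := xb j; case: eqP => //= _ /existsP[y /andP[/sP ys /eqP <-]].
exact: map_f.
Qed.

Lemma b_coloring_card (G : sgraph) (k : nat) (c : {ffun G -> 'I_k})
    (s : seq G) :
  b_coloring c -> (forall x, b_vertex c x -> x \in s) -> k <= size s.
Proof.
move=> /andP[_ /forallP cb] sP; rewrite -(size_map c) -[k in k <= _]size_enum_ord.
apply: uniq_leq_size (enum_uniq _) _ => j _.
by have /existsP[x /andP[/eqP <- /sP xs]] := cb j; exact: map_f.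
Qed.

(** * Edges of a path, indexed by their left ends *)

Section PathEdges.
Variable n : nat.
Implicit Types (e : edge_of (path_graph n)) (u : 'I_n).

(* The endpoints [i] and [i.+1] sum to [2 * i + 1]. *)
Definition edge_idx e : nat := (\sum_(x in val e) (x : 'I_n))./2.

Lemma edge_idxP e :
  exists i j : 'I_n, [/\ edge_idx e = i, j = i.+1 :> nat & val e = [set i; j]].
Proof.
have idxE (i j : 'I_n) : j = i.+1 :> nat -> (\sum_(x in [set i; j]) (x : nat))./2 = i.
  move=> ij; rewrite big_setU1 /= ?big_set1; first by rewrite ij; lia.
  by rewrite inE -val_eqE /= ij; lia.
rewrite /edge_idx; case: e => e /= /imsetP[[i j] /=]; rewrite inE /= => /orP[] /eqP ij ->.
  by exists i, j; split=> //; exact: idxE.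
exists j, i; rewrite setUC; split=> //; exact: idxE.
Qed.

Lemma mem_path_edge u e :
  (u \in val e) = (u == edge_idx e :> nat) || (u == (edge_idx e).+1 :> nat).
Proof. by have [i [j [-> ji ->]]] := edge_idxP e; rewrite !inE -!val_eqE /= ji. Qed.

Lemma edge_idx_lt e : (edge_idx e).+1 < n.
Proof. by have [i [j [-> <- _]]] := edge_idxP e. Qed.

Lemma edge_idx_inj : injective edge_idx.
Proof.
move=> e e' ee'; apply: val_inj; apply/setP=> u.
by have := mem_path_edge u e; rewrite ee' -mem_path_edge.
Qed.

Lemma edge_idx_surj (i : nat) : i.+1 < n -> exists e, edge_idx e = i.
Proof.
move=> i1n; pose a := Ordinal (ltnW i1n); pose b := Ordinal i1n.
have ab : [set a; b] \in edge_set (path_graph n).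
  by apply/imsetP; exists (a, b); rewrite // inE /= /path_rel eqxx.
pose e : edge_of (path_graph n) := exist (fun s => s \in _) _ ab.
exists e; have := mem_path_edge a e; have := mem_path_edge b e.
by rewrite /= !inE !eqxx /= orbT; lia.
Qed.

Lemma size_edges_le (P : pred (edge_of (path_graph n))) (s : seq nat) :
  (forall e, P e -> edge_idx e \in s) -> size (enum P) <= size s.
Proof.
move=> sP; rewrite -(size_map edge_idx); apply: uniq_leq_size.
  by rewrite (map_inj_uniq edge_idx_inj) enum_uniq.
by move=> _ /mapP[e + ->]; rewrite mem_enum => /sP.
Qed.

End PathEdges.

(** * Colorings of the corona of a path and a star *)

Section PathStarCorona.
Variables n t : nat.
Let G := svn_corona (path_graph n) (star_graph t).

(** [ce], [cu], [cc] and [cl] color the edge vertices, the path vertices, the centres and the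
    leaves. Only edge vertices and centres are offered as b-vertices, all other degrees being at
    most 3. *)
Lemma corona_b_colorable (k : nat) (ce cu cc : nat -> nat) (cl : nat -> nat -> nat) :
  (forall i, i.+1 < n -> ce i < k) ->
  (forall i, i < n -> [/\ cu i < k, cc i < k &
     forall j, j < t -> cl i j < k /\ cl i j <> cc i]) ->
  (forall i m, i.+1 < n -> m = i \/ m = i.+1 ->
     [/\ cu m <> ce i, cc m <> ce i & forall j, j < t -> cl m j <> ce i]) ->
  (forall a, a < k ->
     (exists i, [/\ i.+1 < n, ce i = a & forall b, b < k -> b <> a ->
        exists2 m, m = i \/ m = i.+1 &
          [\/ cu m = b, cc m = b | exists2 j, j < t & cl m j = b]]) \/
     (exists i, [/\ i < n, cc i = a & forall b, b < k -> b <> a ->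
        (exists2 j, j < t & cl i j = b) \/
        (exists m, [/\ m.+1 < n, i = m \/ i = m.+1 & ce m = b])])) ->
  b_colorable G k.
Proof.
move=> cek cuk prop cb.
pose f (x : G) : nat := match x with
  | inl (inl u) => cu (u : 'I_n)
  | inl (inr e) => ce (edge_idx e)
  | inr (u, None) => cc (u : 'I_n)
  | inr (u, Some j) => cl (u : 'I_n) (j : 'I_t)
  end.
have inc (u : 'I_n) (e : edge_of (path_graph n)) : u \in val e ->
    [/\ cu u <> ce (edge_idx e), cc u <> ce (edge_idx e) &
        forall j, j < t -> cl u j <> ce (edge_idx e)].
  rewrite mem_path_edge => ue; apply: prop; first exact: edge_idx_lt.
  by case/orP: ue => /eqP; [left|right].
apply: (@b_colorable_of_nat G k f).
- case=> [[u|e]|[u [j|]]] /=.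
  + by case: (cuk _ (ltn_ord u)).
  + exact: cek (edge_idx_lt e).
  + by case: (cuk _ (ltn_ord u)) => _ _ /(_ _ (ltn_ord j)) [].
  + by case: (cuk _ (ltn_ord u)).
- case=> [[u|e]|[u [j|]]] [[v|e']|[v [i|]]] //=.
  + by case/inc.
  + by case/inc => + _ _ => /nesym.
  + by case/inc => _ _ /(_ _ (ltn_ord i)) /nesym.
  + by case/inc => _ + _ => /nesym.
  + by case/inc => _ _ /(_ _ (ltn_ord j)).
  + by rewrite andbF.
  + by case/andP=> /eqP <- _; case: (cuk _ (ltn_ord u)) => _ _ /(_ _ (ltn_ord j)) [].
  + by case/inc.
  + by case/andP=> /eqP <- _; case: (cuk _ (ltn_ord u)) => _ _ /(_ _ (ltn_ord i)) [_ /nesym].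
  + by rewrite andbF.
move=> a /cb [] [i [i_n ia ib]].
  have [e ei] := edge_idx_surj i_n; exists (inl (inr e)); first by rewrite /= ei.
  move=> b bk ba; have [m mi mb] := ib b bk ba.
  have mn : m < n by lia.
  have me : Ordinal mn \in val e.
    by rewrite mem_path_edge ei /=; apply/orP; case: mi => /eqP; [left|right].
  case: mb => [mb|mb|[j jt mb]].
  + by exists (inl (inl (Ordinal mn))).
  + by exists (inr (Ordinal mn, None)).
  + by exists (inr (Ordinal mn, Some (Ordinal jt))).
exists (inr (Ordinal i_n, None)) => // b bk ba.
case: (ib b bk ba) => [[j jt jb]|[m [mn im mb]]].
  by exists (inr (Ordinal i_n, Some (Ordinal jt))); rewrite //= eqxx.
have [e em] := edge_idx_surj mn; exists (inl (inr e)); last by rewrite /= em.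
by rewrite /= mem_path_edge em /=; apply/orP; case: im => /eqP; [left|right].
Qed.

(** * Upper bounds from degrees *)

(* The degrees are [2 * t + 4] at the edge vertices, [t + 2] at the inner
   centres, [t + 1] at the two end centres and at most [3] elsewhere. *)
Lemma corona_b_colorable_le (k : nat) : 1 < t -> 0 < k -> b_colorable G k ->
  [/\ k <= 2 * t + 5, t + 4 <= k -> k <= n - 1,
      t + 3 <= k -> k <= 2 * n - 3 & 5 <= k -> k <= 2 * n - 1].
Proof.
move=> t1 k0 /existsP[c cb].
pose edges (P : pred (edge_of (path_graph n))) : seq G := map (inl \o inr) (enum P).
pose inc (u : 'I_n) : seq G := edges (fun e => u \in val e).
pose centres (P : pred 'I_n) : seq G := map (fun u => inr (u, None)) (enum P).
have incP (u : 'I_n) (e : edge_of (path_graph n)) : u \in val e -> inl (inr e) \in inc u.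
  by move=> ue; apply/mapP; exists e; rewrite // mem_enum.
have size_inc (u : 'I_n) : size (inc u) <= 2 /\
    ((u == 0 :> nat) || (u == n.-1 :> nat) -> size (inc u) <= 1).
  rewrite size_map; split.
    (* The edges at [u] have index [u - 1] or [u]; at [u = 0] truncation merely repeats 0. *)
    apply: (@size_edges_le n _ [:: u.-1; (u : nat)]) => e.
    by rewrite mem_path_edge !inE; lia.
  move=> uend; apply: (@size_edges_le n _ [:: if u == 0 :> nat then 0 else n.-2]) => e.
  have := edge_idx_lt e; rewrite mem_path_edge !inE; case: eqP uend => /=; lia.
have deg_v (u : 'I_n) : b_vertex c (inl (inl u)) -> k <= 3.
  move/(@b_vertex_degree _ _ _ _ (inc u)) => cu; apply: leq_trans (cu _) _.
    by case=> [[v|e]|[v [j|]]] //= /incP.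
  by rewrite ltnS; case: (size_inc u).
have deg_l (u : 'I_n) (j : 'I_t) : b_vertex c (inr (u, Some j)) -> k <= 4.
  move/(@b_vertex_degree G _ _ _ (inr (u, None) :: inc u)) => cu; apply: leq_trans (cu _) _.
    case=> [[v|e]|[v [i|]]] //=; rewrite inE; first by move/incP => ->; rewrite orbT.
      by rewrite andbF.
    by case/andP=> /eqP ->; rewrite eqxx.
  by rewrite /= !ltnS; case: (size_inc u).
have deg_c (u : 'I_n) : b_vertex c (inr (u, None)) -> k <= (t + size (inc u)).+1.
  move/(@b_vertex_degree G _ _ _ ([seq inr (u, Some j) | j <- enum 'I_t] ++ inc u)) => cu.
  apply: leq_trans (cu _) _; last by rewrite size_cat size_map size_enum_ord.
  case=> [[v|e]|[v [i|]]] //=; rewrite mem_cat; first by move/incP => ->; rewrite orbT.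
    case/andP=> /eqP <- _; apply/orP; left; apply/mapP; exists i => //.
    by rewrite mem_enum.
  by rewrite andbF.
have deg_e (e : edge_of (path_graph n)) : b_vertex c (inl (inr e)) -> k <= 2 * t + 5.
  have [i [j [_ _ eij]]] := edge_idxP e.
  pose nb (u : 'I_n) : seq G := inl (inl u) :: [seq inr (u, h) | h <- enum {: option 'I_t}].
  have size_nb (u : 'I_n) : size (nb u) = t + 2.
    by rewrite /= size_map -cardE card_option card_ord; lia.
  have nbv (u : 'I_n) : inl (inl u) \in nb u by rewrite inE eqxx.
  have nbh (u : 'I_n) h : inr (u, h) \in nb u.
    by rewrite inE; apply/orP; right; apply/mapP; exists h; rewrite // mem_enum.
  clearbody nb.
  move/(@b_vertex_degree _ _ _ _ (nb i ++ nb j)) => ce; apply: leq_trans (ce _) _.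
    case=> [[v|e']|[v h]] //=; rewrite eij in_set2 mem_cat.
      by case/orP=> /eqP ->; rewrite nbv ?orbT.
    by case/orP=> /eqP ->; rewrite nbh ?orbT.
  by rewrite size_cat !size_nb; lia.
have size_e : size (edges predT) <= n - 1.
  rewrite size_map -[leqRHS](size_iota 0).
  by apply: size_edges_le => e _; rewrite mem_iota; have := edge_idx_lt e; lia.
have memE (e : edge_of (path_graph n)) : inl (inr e) \in edges predT.
  by apply/mapP; exists e; rewrite // mem_enum.
have memC (P : pred 'I_n) (u : 'I_n) : P u -> inr (u, None) \in centres P.
  by move=> Pu; apply/mapP; exists u; rewrite // mem_enum.
have size_c (P : pred 'I_n) (s : seq nat) : (forall u, P u -> (u : nat) \in s) ->
    size (centres P) <= size s.
  move=> sP; rewrite size_map -(size_map val); apply: uniq_leq_size.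
    by rewrite (map_inj_uniq val_inj) enum_uniq.
  by move=> _ /mapP[u + ->]; rewrite mem_enum => /sP.
split.
- have /andP[_ /forallP/(_ (Ordinal k0))/existsP[x /andP[_]]] := cb.
  case: x => [[u|e]|[u [j|]]].
  + by move/deg_v; lia.
  + exact: deg_e.
  + by move/deg_l; lia.
  + by move/deg_c; have [] := size_inc u; lia.
(* Centres have degree at most [t + 2], so only the [n - 1] edge vertices can be b-vertices. *)
- move=> tk; apply: leq_trans size_e; apply: b_coloring_card cb _.
  case=> [[u|e]|[u [j|]]] //; first by move/deg_v; lia.
  + by move/deg_l; lia.
  + by move/deg_c; have [] := size_inc u; lia.
(* The end centres have degree [t + 1], which leaves the edge vertices and [n - 2] inner centres. *)
- move=> tk; pose P (u : 'I_n) := 0 < u < n.-1.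
  apply: leq_trans (_ : size (edges predT ++ centres P) <= _); last first.
    rewrite size_cat; apply: leq_trans (leq_add size_e (@size_c P (iota 1 (n - 2)) _)) _.
      by move=> u; rewrite mem_iota /P; lia.
    by rewrite size_iota; lia.
  apply: b_coloring_card cb _.
  case=> [[u|e]|[u [j|]]] //; rewrite mem_cat; first by move/deg_v; lia.
  + by rewrite memE.
  + by move/deg_l; lia.
  + move/deg_c => ku; apply/orP; right; apply: memC; rewrite /P.
    by have := ltn_ord u; have [] := size_inc u; lia.
- move=> tk.
  apply: leq_trans (_ : size (edges predT ++ centres predT) <= _); last first.
    rewrite size_cat; apply: leq_trans (leq_add size_e (@size_c predT (iota 0 n) _)) _.
      by move=> u; rewrite mem_iota /=.
    by rewrite size_iota; lia.
  apply: b_coloring_card cb _.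
  case=> [[u|e]|[u [j|]]] //; rewrite mem_cat; first by move/deg_v; lia.
  + by rewrite memE.
  + by move/deg_l; lia.
  + by rewrite memC ?orbT.
Qed.

(** * The periodic coloring *)

(* With [e_i] colored [i %% k], the vertices [u_i], [c_i] and the leaves of
   copy [i] take the colors [i + 1], [i + 3], [i + 5], and so on.  The
   neighbours of [e_i] in the blocks of [u_i] and [u_i.+1] then carry the
   colors at odd and at even distance from [i].  The cap [k - 2] handles the
   distance [k - 1] when [k] is even and wastes no color when [k] is odd. *)
Lemma corona_b_colorable_cyclic (k : nat) :
  7 <= k -> k <= 2 * t + 5 -> k <= n - 1 -> b_colorable G k.
Proof.
move=> k7 kt kn; pose off s := minn (2 * s + 1) (k - 2).
pose slot i s := (i + off s) %% k.
have k0 : 0 < k by lia.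
have modk x : x %% k < k by rewrite ltn_pmod.
have addmod i x y : x < k -> y < k -> (i + x) %% k = (i + y) %% k -> x = y.
  by move=> xk yk /eqP; rewrite eqn_modDl !modn_small // => /eqP.
have offb s : 0 < off s <= k - 2 by rewrite /off; lia.
(* The cap [k - 2] keeps both [off s] and [(off s).+1] strictly between 0 and [k]. *)
have slot_ne i m s : m = i \/ m = i.+1 -> slot m s <> i %% k.
  case=> ->; rewrite -[i in RHS]addn0 => eq_i; have ob := offb s.
    by have := addmod _ _ _ _ _ eq_i; lia.
  by move: eq_i; rewrite /slot addSnnS => /addmod; lia.
have slotP m s b : s <= t.+1 -> slot m s = b ->
    [\/ slot m 0 = b, slot m 1 = b | exists2 j, j < t & slot m j.+2 = b].
  case: s => [|[|s]] st sb; [by apply: Or31|by apply: Or32|apply: Or33].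
  by exists s.
apply: (@corona_b_colorable k (fun i => i %% k) (slot^~ 0) (slot^~ 1)
          (fun i j => slot i j.+2)) => //.
- move=> i _; split=> [||j _]; [exact: modk|exact: modk|split; first exact: modk].
  (* As [7 <= k], [off 1] is 3 while the offset of a leaf is at least 5. *)
  apply: contra_not (_ : off j.+2 <> off 1).
    by have := offb 1; have := offb j.+2; move=> ? ? /addmod; apply; lia.
  by rewrite /off; lia.
- by move=> i m _ im; split=> [||j _]; exact: slot_ne.
move=> a ak; left; exists a; split; [lia|by rewrite modn_small|move=> b bk ba].
have [d d0 ->] : exists2 d, 0 < d < k & b = (a + d) %% k.
  have [ab|] := ltnP a b; first by exists (b - a); rewrite ?subnKC ?modn_small //; lia.
  exists (b + k - a); first lia.
  by have -> : a + (b + k - a) = b + k by [lia]; rewrite modnDr modn_small.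
(* Odd distances up to [k - 2] are found in block [a]. The others are found in block [a.+1], at
   offset [d - 1]. *)
have [/andP[dk d_odd]|d_even] := boolP ((d <= k - 2) && odd d).
  exists a; [by left|apply: (slotP _ d./2); first lia].
  by rewrite /slot /off; congr (_ %% k); lia.
exists a.+1; [by right|have [dk|dk] := eqVneq d k.-1].
  (* The last slot reaches the cap, because [k <= 2 * t + 5]. *)
  by apply: (slotP _ t.+1) => //; rewrite /slot /off; congr (_ %% k); lia.
apply: (slotP _ d.-1./2); first lia.
by rewrite /slot /off; congr (_ %% k); lia.
Qed.

(** * The coloring with distinct colors on the edge vertices *)

(* The edge vertex [e_i] has color [i]; the remaining colors [n - 1], ...,
   [k - 1] are put on the centres, those of inner copies only when [d = 1]. The
   leaves of copy [i] take the colors that its centre would otherwise miss. *)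
Lemma corona_b_colorable_small (k d : nat) :
  2 < n -> 3 < k -> d <= 1 -> n - 1 <= k -> k <= t + 2 + d ->
  k + 2 * d <= 2 * n - 1 -> b_colorable G k.
Proof.
move=> n2 k3 d1 nk kt kd.
(* The leaves of copy [a] avoid color [a - 1], so [e_a] finds it on [u_(a+1)]; [e_0] works with copy
   1 and finds color 1 on [u_0]. The color of [u_1] only has to avoid 0 and 1. *)
pose cu i := if i is i'.+2 then i' else i.+1.
pose cc i := if n - 1 - d + i < k then n - 1 - d + i else if i <= 1 then 2 else 0.
(* Truncation at both ends of the path makes the two edge colors coincide for an end copy. *)
pose ex i := [:: cc i; minn i (n - 2); i.-1].
(* Leaves beyond the length of [L i] repeat its first color; [3 < k] makes [L i] nonempty. *)
pose L i := [seq x <- iota 0 k | x \notin ex i].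
pose cl i j := nth (head 0 (L i)) (L i) j.
have memL i x : (x \in L i) = (x \notin ex i) && (x < k).
  by rewrite mem_filter mem_iota.
have cck i : cc i < k by rewrite /cc; case: ifP => //; case: ifP; lia.
have clL i j : cl i j \in L i.
  have : 0 < size (L i).
    have := uniq_leq_size (iota_uniq 0 k) (s2 := ex i ++ L i).
    rewrite size_cat size_iota /= => h; have := h; suff: {subset iota 0 k <= ex i ++ L i}.
      by move=> /h; lia.
    by move=> x; rewrite mem_cat memL mem_iota /= => ->; rewrite andbT orbN.
  rewrite /cl; have [jL|Lj] := ltnP j (size (L i)); first by rewrite mem_nth.
  by rewrite nth_default //; case: (L i) => //= x s _; rewrite inE eqxx.
have cl_onto i b : i < n -> (d <= i < n - d) || (0 < i < n - 1) ->
    b < k -> b \notin ex i -> exists2 j, j < t & cl i j = b.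
  move=> i_n i_d bk bex; have bL : b \in L i by rewrite memL bex.
  exists (index b (L i)); last by rewrite /cl nth_index.
  have : index b (L i) < size (L i) by rewrite index_mem.
  move/leq_trans; apply.
  have uL : uniq (L i) by rewrite filter_uniq ?iota_uniq.
  have bound s : uniq s -> {subset s <= ex i} -> all (ltn^~ k) s -> size s + size (L i) <= k.
    move=> us sex sk; rewrite -size_cat -[leqRHS](size_iota 0).
    apply: uniq_leq_size.
      rewrite cat_uniq us uL andbT /=; apply/hasPn => x; rewrite memL => /andP[xex _].
      by apply: contra xex => /sex.
    move=> x; rewrite mem_cat memL mem_iota add0n /=.
    by case/orP=> [/(allP sk)|/andP[]].
  (* An inner copy excludes three distinct colors, leaving [k - 3 <= t]. An end copy excludes only
     two, but there [d = 0] and [k - 2 <= t]. *)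
  have [inner|outer] := boolP (0 < i < n - 1).
    have := bound (ex i); rewrite /= !inE /= cck => /(_ _ (fun x => id)).
    suff: uniq (ex i) by rewrite /= !inE => h /(_ h); lia.
    by rewrite /= !inE /cc; case: ifP; [lia|case: ifP; lia].
  have := bound [:: cc i; minn i (n - 2)].
  rewrite /= !inE cck; have -> : minn i (n - 2) < k by lia.
  have -> : cc i != minn i (n - 2) by rewrite /cc; case: ifP; [lia|case: ifP; lia].
  move/(_ isT); suff: {subset [:: cc i; minn i (n - 2)] <= ex i} by move=> h /(_ h isT); lia.
  by move=> x; rewrite !inE => /orP[] ->; rewrite ?orbT.
apply: (@corona_b_colorable k id cu cc cl).
- by move=> i; lia.
- move=> i i_n; split=> //; first by rewrite /cu; case: i i_n => [|[|i]]; lia.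
  move=> j _; have := clL i j; rewrite memL => /andP[cl_ex ->].
  by split=> // eq_c; rewrite eq_c inE eqxx in cl_ex.
- move=> i m i_n im; split.
  + by rewrite /cu; case: m im => [|[|m]]; lia.
  + by rewrite /cc; case: ifP; [lia|case: ifP; lia].
  + move=> j _ eq_c; have := clL m j; rewrite memL eq_c /ex !inE; lia.
move=> a ak; have [an|an] := ltnP a (n - 1).
  (* The copy [maxn a 1] is an inner copy adjacent to [e_a], so its leaves show every color outside
     [ex m]. *)
  left; exists a; split=> //; first lia.
  move=> b bk ba; pose m := maxn a 1.
  have [bm|bm] := boolP (b \in ex m); last first.
    exists m; first lia.
    by apply: Or33; apply: cl_onto; rewrite // /m; lia.
  have [->|bc] := eqVneq b (cc m); first by exists m; [lia|apply: Or32].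
  exists (if a is 0 then 0 else a.+1); first by case: (a); auto.
  apply: Or31; move: bm ba; rewrite !inE (negPf bc) /m /cu.
  by case: (a) an => [|a']; lia.
(* This inverts [cc]; the bound [k + 2 * d <= 2 * n - 1] keeps the index below [n - d]. The excluded
   colors other than [a] are seen on the incident edge vertices. *)
right; exists (a - (n - 1) + d); set i := (X in X < n).
have i_n : i < n by lia.
split=> //; first by rewrite /cc ifT; lia.
move=> b bk ba; have [bi|bi] := boolP (b \in ex i); last first.
  by left; apply: cl_onto => //; lia.
right; exists b; move: bi; rewrite !inE.
have -> : cc i = a by rewrite /cc ifT; lia.
by split=> //; lia.
Qed.

End PathStarCorona.

Theorem theorem8 (n t : nat) (hn : 2 < n) (ht : 2 < t) :
  b_chromatic_number (svn_corona (path_graph n) (star_graph t)) =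
    if 2 * n <= t + 3 then 2 * n - 1
    else if n == uphalf (t + 4) then t + 2
    else if (uphalf (t + 4) < n) && (n <= t + 4) then t + 3
    else if (t + 4 < n) && (n <= 2 * t + 5) then n - 1
    else 2 * t + 5.
Proof.
set G := svn_corona _ _.
set K := (RHS).
have KG : b_colorable G K.
  rewrite /K; case: ifP => c1.
    by apply: (@corona_b_colorable_small _ _ _ 0); lia.
  case: eqP => c2; first by apply: (@corona_b_colorable_small _ _ _ 0); lia.
  (* Having [t + 3] colors requires b-vertices of degree [t + 2], hence inner centres only. *)
  case: ifP => c3; first by apply: (@corona_b_colorable_small _ _ _ 1); lia.
  by case: ifP => c4; apply: corona_b_colorable_cyclic; lia.
apply/eqP; rewrite eqn_leq b_chromatic_number_max // andbT.
have := b_chromatic_number_attained G; have := b_chromatic_number_max KG.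
move: (b_chromatic_number G) => k kK.
(* This makes the bound [2 * n - 1] available. *)
have k5 : 4 < k by apply: leq_trans kK; rewrite /K; repeat case: ifP => ?; lia.
move=> kb; have [||h1 h2 h3 h4] := corona_b_colorable_le _ _ kb; [lia|lia|].
by rewrite /K; repeat case: ifP => ?; lia.
Qed.
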